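(* Every unitary pseudo BL-ring with left and right unit is isomorphic to a subring of a direct product of special primary rings.
   Context: Rings are associative, not necessarily commutative; ''ideal'' means two-sided ideal. A ring $R$ is generated by idempotents if for every $x\in R$ there is an idempotent $e\in R$ with $ex=xe=x$. For ideals $I,J$ of $R$, $I\cdot J$ is the usual product of ideals, $I\rightarrow J:=\{x\in R\mid xI\subseteq J\}$ and $I\rightsquigarrow J:=\{x\in R\mid Ix\subseteq J\}$. A ring $R$ generated by idempotents is a pseudo BL-ring if for all ideals $I,J$: (PBLR-1) $I\cap J=I\cdot(I\rightsquigarrow J)=(I\rightarrow J)\cdot I$; (PBLR-2) $(I\rightarrow J)+(J\rightarrow I)=(I\rightsquigarrow J)+(J\rightsquigarrow I)=R$. ''Unitary with left and right unit'' means that $R$ has a left identity $1_L$ and a right identity $1_R$. A ring is a special primary ring if it has a unique maximal ideal $M$ and each proper ideal is a power of $M$. *)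

(* Defs.v *)
From HB Require Import structures.
From mathcomp Require Import all_boot all_algebra.
From mathcomp Require Import boolp classical_sets functions.

Set Implicit Arguments.
Unset Strict Implicit.
Unset Printing Implicit Defensive.

Import GRing.Theory.

Local Open Scope classical_set_scope.
Local Open Scope ring_scope.

(* Associative rings, not assumed commutative, unital or nonzero. MathComp's
   pzRingType has a two-sided unit built in, so it is not used here. *)
HB.mixin Record Zmodule_isRng R of GRing.Zmodule R := {
  rmul : R -> R -> R;
  rmulA : associative rmul;
  rmulDl : left_distributive rmul +%R;
  rmulDr : right_distributive rmul +%R
}.

#[short(type="rngType")]
HB.structure Definition Rng := {R of Zmodule_isRng R & GRing.Zmodule R}.

Declare Scope rng_scope.
Delimit Scope rng_scope with rng.
Notation "x ** y" := (rmul x y) (at level 40, left associativity) : rng_scope.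
Local Open Scope rng_scope.

Section Ideals.
Variable R : rngType.
Implicit Types (I J M : set R) (x e : R).

Definition left_unit e := forall x, e ** x = x.
Definition right_unit e := forall x, x ** e = x.

Definition generated_by_idempotents :=
  forall x, exists e, [/\ e ** e = e, e ** x = x & x ** e = x].

Definition is_ideal I :=
  [/\ I 0, forall x y, I x -> I y -> I (x - y),
      forall r x, I x -> I (r ** x) & forall r x, I x -> I (x ** r)].

Definition ideal_mul I J : set R :=
  [set x | exists (n : nat) (a b : 'I_n -> R),
    [/\ forall i, I (a i), forall i, J (b i) & x = \sum_(i < n) a i ** b i]].

Definition ideal_add I J : set R :=
  [set x | exists2 a, I a & exists2 b, J b & x = a + b].

Definition arrow I J : set R := [set x | forall y, I y -> J (x ** y)].
Definition squig I J : set R := [set x | forall y, I y -> J (y ** x)].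

Definition pseudo_BL_ring :=
  [/\ generated_by_idempotents,
      forall I J, is_ideal I -> is_ideal J ->
        I `&` J = ideal_mul I (squig I J) /\ I `&` J = ideal_mul (arrow I J) I
    & forall I J, is_ideal I -> is_ideal J ->
        ideal_add (arrow I J) (arrow J I) = setT /\
        ideal_add (squig I J) (squig J I) = setT].

Definition proper_ideal I := is_ideal I /\ I <> setT.

Definition maximal_ideal M :=
  proper_ideal M /\ forall J, proper_ideal J -> M `<=` J -> J = M.

(* ideal_exp M n is M^(n+1): the zeroth power is left out, as there is no unit. *)
Fixpoint ideal_exp M (n : nat) : set R :=
  if n is n'.+1 then ideal_mul (ideal_exp M n') M else M.

Definition special_primary :=
  exists M, [/\ maximal_ideal M, forall N, maximal_ideal N -> N = M
    & forall J, proper_ideal J -> exists n, J = ideal_exp M n].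

(* Closed under the ring operations; no unit is required. *)
Definition is_subring (B : set R) :=
  [/\ B 0, forall x y, B x -> B y -> B (x - y)
    & forall x y, B x -> B y -> B (x ** y)].

End Ideals.

Definition rng_morphism (R S : rngType) (f : R -> S) :=
  {morph f : x y / x + y} /\ {morph f : x y / x ** y}.

Definition isomorphic_to_subring (R S : rngType) :=
  exists B : set S, is_subring B /\
    exists f : R -> S, rng_morphism f /\ set_bij [set: R] B f.

Definition rng_prod (I : Type) (S : I -> rngType) := forall i, S i.

Section RngProd.
Variables (I : Type) (S : I -> rngType).
Local Notation P := (rng_prod S).

HB.instance Definition _ := gen_eqMixin P.
HB.instance Definition _ := gen_choiceMixin P.

Definition prod_zero : P := fun i => 0.
Definition prod_opp (f : P) : P := fun i => - f i.
Definition prod_add (f g : P) : P := fun i => f i + g i.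
Definition prod_mul (f g : P) : P := fun i => f i ** g i.

Fact prod_addA : associative prod_add.
Proof. by move=> f g h; apply: functional_extensionality_dep => i; apply: addrA. Qed.
Fact prod_addC : commutative prod_add.
Proof. by move=> f g; apply: functional_extensionality_dep => i; apply: addrC. Qed.
Fact prod_add0 : left_id prod_zero prod_add.
Proof. by move=> f; apply: functional_extensionality_dep => i; apply: add0r. Qed.
Fact prod_addN : left_inverse prod_zero prod_opp prod_add.
Proof. by move=> f; apply: functional_extensionality_dep => i; apply: addNr. Qed.

HB.instance Definition _ :=
  GRing.isZmodule.Build P prod_addA prod_addC prod_add0 prod_addN.

Fact prod_mulA : associative prod_mul.
Proof. by move=> f g h; apply: functional_extensionality_dep => i; apply: rmulA. Qed.
Fact prod_mulDl : left_distributive prod_mul +%R.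
Proof. by move=> f g h; apply: functional_extensionality_dep => i; apply: rmulDl. Qed.
Fact prod_mulDr : right_distributive prod_mul +%R.
Proof. by move=> f g h; apply: functional_extensionality_dep => i; apply: rmulDr. Qed.

HB.instance Definition _ :=
  Zmodule_isRng.Build P prod_mulA prod_mulDl prod_mulDr.

End RngProd.

(* Main.v *)
(* A nonzero x is separated by one of three kinds of maps.  If x is not torsion,
   or if p x = 0 and x is not in pR for a prime p, some additive functional from
   R to a prime field does not vanish at x, and letting R act on a large space
   of functions built from such functionals makes x a factor of the identity;
   x then survives in a simple quotient of an endomorphism ring.  This
   map is not onto: R can have idempotent maximal ideals (finite-rank operators
   in End V), so special primary quotients of R alone do not suffice.  If p x = 0
   and x is in pR, divisibility and prelinearity show that x lies outside a power
   of some maximal ideal N, and each R/N^k is special primary.  A general torsion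
   element has a nonzero multiple killed by a prime. *)
From Pilot Require Import Defs.
From HB Require Import structures.
From mathcomp Require Import all_boot all_algebra.
From mathcomp Require Import boolp classical_sets functions.

Set Implicit Arguments.
Unset Strict Implicit.
Unset Printing Implicit Defensive.

Import GRing.Theory Num.Theory.
(* all_algebra has its own proper_ideal, which hides the one of Defs. *)
Import Pilot.Defs.

Local Open Scope classical_set_scope.
Local Open Scope ring_scope.
Local Open Scope rng_scope.

(** * Zorn's lemma for families of sets *)

(** Zorn's lemma is applied to the sets A such that [A] union [A0] satisfies P. The empty chain is
    then covered by [P A0], so closure is asked only of nonempty chains. *)
Lemma Zorn_bigcup_above (T : Type) (P : set (set T)) (A0 : set T) :
    P A0 ->
    (forall F : set (set T), F !=set0 -> F `<=` P -> total_on F subset ->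
      P (\bigcup_(X in F) X)) ->
  exists A, [/\ P A, A0 `<=` A & forall B, P B -> A `<=` B -> B = A].
Proof.
move=> PA0 Pcup.
have [F FP Ftot|A [PA Amax]] := @Zorn_bigcup T (fun A => P (A `|` A0)).
  have [[X0 FX0]|F0] := pselect (F !=set0); last first.
    have -> : \bigcup_(X in F) X = set0.
      by rewrite -subset0 => x [X FX _]; apply: F0; exists X.
    by rewrite set0U.
  have -> : (\bigcup_(X in F) X) `|` A0 =
            \bigcup_(X in [set Y `|` A0 | Y in F]) X.
    apply/seteqP; split=> x.
      case=> [[X FX Xx]|A0x]; first by exists (X `|` A0); [exists X|left].
      by exists (X0 `|` A0); [exists X0|right].
    by case=> _ [X FX <-] [Xx|]; [left; exists X|right].
  apply: Pcup; first by exists (X0 `|` A0), X0.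
    by move=> _ [X FX <-]; apply: FP.
  by move=> _ _ [X FX <-] [Y FY <-]; have [] := Ftot _ _ FX FY => XY; [left|right];
    apply: setSU.
exists (A `|` A0); split=> // B PB AB.
have [AA A0B] : A `<=` B /\ A0 `<=` B by split=> x ?; apply: AB; [left|right].
apply/seteqP; split=> // x Bx; left; apply: contrapT => nAx.
apply: (Amax B); first by split=> // BA; apply/nAx/BA.
by rewrite setUidl.
Qed.

(** * Arithmetic of ideals in rings without a built-in unit *)

Section RngTheory.
Variable R : rngType.
Implicit Types (x y z : R) (n : nat).

Lemma rmul0 x : x ** 0 = 0.
Proof. by apply: (addrI (x ** 0)); rewrite -rmulDr !addr0. Qed.
Lemma r0mul x : 0 ** x = 0.
Proof. by apply: (addrI (0 ** x)); rewrite -rmulDl !addr0. Qed.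
Lemma rmulN x y : x ** (- y) = - (x ** y).
Proof. by apply: (addrI (x ** y)); rewrite -rmulDr !subrr rmul0. Qed.
Lemma rNmul x y : (- x) ** y = - (x ** y).
Proof. by apply: (addrI (x ** y)); rewrite -rmulDl !subrr r0mul. Qed.
Lemma rmulBr x y z : x ** (y - z) = x ** y - x ** z.
Proof. by rewrite rmulDr rmulN. Qed.
Lemma rmulBl x y z : (y - z) ** x = y ** x - z ** x.
Proof. by rewrite rmulDl rNmul. Qed.
Lemma rmulMnr x y n : x ** (y *+ n) = (x ** y) *+ n.
Proof. by elim: n => [|n IH]; rewrite ?rmul0 // !mulrS rmulDr IH. Qed.
Lemma rmulMnl x y n : (x *+ n) ** y = (x ** y) *+ n.
Proof. by elim: n => [|n IH]; rewrite ?r0mul // !mulrS rmulDl IH. Qed.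
Lemma rmul_sumr n x (a : 'I_n -> R) : x ** (\sum_i a i) = \sum_i x ** a i.
Proof.
by elim/big_rec2: _ => [|i u v _ IH]; rewrite ?rmul0 // rmulDr IH.
Qed.
Lemma rmul_suml n x (a : 'I_n -> R) : (\sum_i a i) ** x = \sum_i a i ** x.
Proof.
by elim/big_rec2: _ => [|i u v _ IH]; rewrite ?r0mul // rmulDl IH.
Qed.

Implicit Types (I J K : set R).

Section IdealClosure.
Variables (I : set R) (hI : is_ideal I).
Lemma ideal0 : I 0. Proof. by case: hI. Qed.
Lemma idealB x y : I x -> I y -> I (x - y). Proof. by case: hI => ? h _ _; apply: h. Qed.
Lemma idealN x : I x -> I (- x).
Proof. by move=> Ix; rewrite -sub0r; apply: idealB => //; apply: ideal0. Qed.
Lemma idealD x y : I x -> I y -> I (x + y).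
Proof. by move=> Ix Iy; rewrite -[y]opprK; apply: idealB => //; apply: idealN. Qed.
Lemma idealMl r x : I x -> I (r ** x). Proof. by case: hI => ? _ h _; apply: h. Qed.
Lemma idealMr r x : I x -> I (x ** r). Proof. by case: hI => ? _ _ h; apply: h. Qed.
Lemma ideal_sum n (a : 'I_n -> R) : (forall i, I (a i)) -> I (\sum_i a i).
Proof. by move=> h; elim/big_ind: _ => //; [exact: ideal0|exact: idealD]. Qed.
End IdealClosure.

Lemma ideal_mul_mem I J x y : I x -> J y -> ideal_mul I J (x ** y).
Proof.
by move=> Ix Jy; exists 1%N, (fun=> x), (fun=> y); split=> //; rewrite big_ord1.
Qed.

Lemma ideal_mul_min I J K : is_ideal K ->
  (forall x y, I x -> J y -> K (x ** y)) -> ideal_mul I J `<=` K.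
Proof. by move=> hK h _ [n [a [b [Ia Jb ->]]]]; apply: ideal_sum => // i; apply: h. Qed.

Lemma is_ideal_mul I J : is_ideal I -> is_ideal J -> is_ideal (ideal_mul I J).
Proof.
move=> hI hJ; split.
- by exists 0%N, (fun=> 0), (fun=> 0); split; [case|case|rewrite big_ord0].
- move=> _ _ [n [a [b [Ia Jb ->]]]] [m [c [d [Ic Jd ->]]]].
  (* A difference of two finite sums is one sum over the concatenated index range, the sign being
     absorbed in the left factors. *)
  exists (n + m)%N, (fun i => match fintype.split i with inl j => a j | inr j => - c j end),
    (fun i => match fintype.split i with inl j => b j | inr j => d j end); split.
  + by move=> i; case: (fintype.split i) => // j; apply: idealN.
  + by move=> i; case: (fintype.split i).
  + rewrite big_split_ord -sumrN; congr (_ + _); apply: eq_bigr => i _.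
      by rewrite (unsplitK (inl i)).
    by rewrite (unsplitK (inr i)) rNmul.
- move=> r _ [n [a [b [Ia Jb ->]]]]; exists n, (fun i => r ** a i), b; split=> //.
    by move=> i; apply: idealMl.
  by rewrite rmul_sumr; apply: eq_bigr => i _; rewrite rmulA.
- move=> r _ [n [a [b [Ia Jb ->]]]]; exists n, a, (fun i => b i ** r); split=> //.
    by move=> i; apply: idealMr.
  by rewrite rmul_suml; apply: eq_bigr => i _; rewrite rmulA.
Qed.

Lemma is_ideal_exp I k : is_ideal I -> is_ideal (ideal_exp I k).
Proof. by move=> hI; elim: k => //= k IH; apply: is_ideal_mul. Qed.

Lemma ideal_mulS I I' J J' : I `<=` I' -> J `<=` J' ->
  ideal_mul I J `<=` ideal_mul I' J'.
Proof.
by move=> II JJ _ [n [a [b [Ia Jb ->]]]]; exists n, a, b; split=> // i; [apply: II|apply: JJ].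
Qed.

Lemma ideal_mul_subl I J : is_ideal I -> ideal_mul I J `<=` I.
Proof. by move=> hI; apply: ideal_mul_min => // x y Ix _; apply: idealMr. Qed.

Lemma ideal_expS I k l : is_ideal I -> (k <= l)%N -> ideal_exp I l `<=` ideal_exp I k.
Proof.
move=> hI /subnK <-; elim: (l - k)%N => // m IH.
by rewrite addSn; apply: subset_trans IH; apply: ideal_mul_subl; apply: is_ideal_exp.
Qed.

Lemma is_ideal_arrow I J : is_ideal I -> is_ideal J -> is_ideal (arrow I J).
Proof.
move=> hI hJ; split=> [y _|x y Ix Iy z Iz|r x Ix z Iz|r x Ix z Iz].
- by rewrite r0mul; apply: ideal0.
- by rewrite rmulBl; apply: idealB; [|apply: Ix|apply: Iy].
- by rewrite -rmulA; apply: idealMl => //; apply: Ix.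
- by rewrite -rmulA; apply: Ix; apply: idealMl.
Qed.

Lemma is_ideal_squig I J : is_ideal I -> is_ideal J -> is_ideal (squig I J).
Proof.
move=> hI hJ; split=> [y _|x y Ix Iy z Iz|r x Ix z Iz|r x Ix z Iz].
- by rewrite rmul0; apply: ideal0.
- by rewrite rmulBr; apply: idealB; [|apply: Ix|apply: Iy].
- by rewrite rmulA; apply: Ix; apply: idealMr.
- by rewrite rmulA; apply: idealMr => //; apply: Ix.
Qed.

Lemma is_ideal_add I J : is_ideal I -> is_ideal J -> is_ideal (ideal_add I J).
Proof.
move=> hI hJ; split.
- by exists 0; [exact: ideal0|exists 0; [exact: ideal0|rewrite addr0]].
- move=> _ _ [a Ia [b Jb ->]] [c Ic [d Jd ->]]; exists (a - c); first exact: idealB.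
  by exists (b - d); [exact: idealB|rewrite opprD addrACA].
- move=> r _ [a Ia [b Jb ->]]; exists (r ** a); first exact: idealMl.
  by exists (r ** b); [exact: idealMl|rewrite rmulDr].
- move=> r _ [a Ia [b Jb ->]]; exists (a ** r); first exact: idealMr.
  by exists (b ** r); [exact: idealMr|rewrite rmulDl].
Qed.

Lemma is_ideal_bigcap (T : Type) (f : T -> set R) :
  (forall t, is_ideal (f t)) -> is_ideal [set x | forall t, f t x].
Proof.
move=> hf; split=> [t|x y fx fy t|r x fx t|r x fx t].
- exact: ideal0.
- exact: idealB.
- exact: idealMl.
- exact: idealMr.
Qed.

Lemma is_ideal_multiples n : is_ideal (range (fun z => z *+ n)).
Proof.
split; first by exists 0; rewrite // mul0rn.
- by move=> _ _ [x _ <-] [y _ <-]; exists (x - y); rewrite // mulrnBl.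
- by move=> r _ [x _ <-]; exists (r ** x); rewrite // rmulMnr.
- by move=> r _ [x _ <-]; exists (x ** r); rewrite // rmulMnl.
Qed.

(** * Maximal ideals in rings with a unit *)

Definition two_sided_unit (e : R) := left_unit e /\ right_unit e.

Section Unital.
Variables (e : R) (he : two_sided_unit e).
Let e_l : forall x, e ** x = x := he.1.
Let e_r : forall x, x ** e = x := he.2.

Lemma ideal_eqT I : is_ideal I -> I e -> I = setT.
Proof.
by move=> hI Ie; apply/seteqP; split=> // x _; rewrite -(e_l x); apply: idealMr.
Qed.

(** With a unit, being proper means missing [e], a condition that passes to unions of chains; Zorn's
    lemma applies. *)
Lemma maximal_ideal_exists I : proper_ideal I ->
  exists2 N, maximal_ideal N & I `<=` N.
Proof.
case=> hI IT; pose P (J : set R) := is_ideal J /\ ~ J e.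
have PE J : P J <-> proper_ideal J.
  split=> -[hJ Je]; split=> // JE; apply: Je; first by rewrite JE.
  exact: ideal_eqT.
have [|F [X0 FX0] FP Ftot|N [/PE hN IN Nmax]] := @Zorn_bigcup_above _ P I.
- exact/PE.
- have Fid X : F X -> is_ideal X by move=> /FP[].
  split; last by case=> X /FP[_ Xe] /Xe.
  split; first by exists X0 => //; exact: ideal0 (Fid _ FX0).
  + move=> x y [X FX Xx] [Y FY Yy].
    by have [XY|YX] := Ftot _ _ FX FY; [exists Y|exists X] => //;
      apply: idealB => //; [exact: Fid|exact: XY|exact: Fid|exact: YX].
  + by move=> r x [X FX Xx]; exists X => //; apply: idealMl => //; apply: Fid.
  + by move=> r x [X FX Xx]; exists X => //; apply: idealMr => //; apply: Fid.
- by exists N => //; split=> // J /PE PJ; apply: Nmax.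
Qed.

Section Maximal.
Variables (N : set R) (hN : maximal_ideal N).
Let idN : is_ideal N := hN.1.1.

Lemma maximal_idealPn I : is_ideal I -> ~ I `<=` N -> exists2 i, I i & N (e - i).
Proof.
move=> hI IN; have hIN := is_ideal_add hI idN.
have [INT|INT] := pselect (ideal_add I N = setT).
  have [i Ii [m Nm em]] : ideal_add I N e by rewrite INT.
  by exists i => //; rewrite em addrC addKr.
case: IN => x Ix; rewrite -(hN.2 (ideal_add I N)).
- by exists x => //; exists 0; [exact: ideal0|rewrite addr0].
- by [].
- by move=> z Nz; exists 0; [exact: ideal0|exists z; rewrite ?add0r].
Qed.

Lemma maximal_ideal_notin : ~ N e.
Proof. by move=> /(ideal_eqT idN); apply: hN.1.2. Qed.

(** An ideal comaximal with N is comaximal with every power of N: if [e - j] lies in a power and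
    [e - i] in N, with i and j in I, then (e - j)(e - i) lies in the next power and is again [e]
    minus an element of I. *)
Lemma ideal_exp_sub_maximal I k : is_ideal I -> ideal_exp N k `<=` I ->
  ~ I `<=` N -> I = setT.
Proof.
move=> hI NkI IN; have [i Ii Ni] := maximal_idealPn hI IN.
suff [j Ij Nj] : exists2 j, I j & ideal_exp N k (e - j).
  by apply: ideal_eqT => //; rewrite -(subrK j e); apply: idealD => //; apply: NkI.
elim: k {NkI} => [|k [j Ij Nj]]; first by exists i.
exists (j + (e - j) ** i); first by apply: idealD => //; apply: idealMl.
have -> : e - (j + (e - j) ** i) = (e - j) ** (e - i).
  by rewrite rmulBr e_r opprD addrA.
exact: ideal_mul_mem.
Qed.

End Maximal.
End Unital.

End RngTheory.

(** * Quotient of a ring by an ideal *)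

Section Quotient.
Variables (R : rngType) (I : set R) (hI : is_ideal I).

(** Membership in I is a proposition; the boolean reflection is what [EquivRel] requires. *)
Definition quot_rel (x y : R) := `[< I (x - y) >].

Fact quot_rel_refl : reflexive quot_rel.
Proof. by move=> x; apply/asboolP; rewrite subrr; apply: ideal0. Qed.
Fact quot_rel_sym : symmetric quot_rel.
Proof.
by move=> x y; apply: asbool_equiv_eq; split=> h; rewrite -opprB; apply: idealN.
Qed.
Fact quot_rel_trans : transitive quot_rel.
Proof.
move=> y x z /asboolP xy /asboolP yz; apply/asboolP.
by rewrite -(subrKA y); apply: idealD.
Qed.

Canonical quot_equiv := EquivRel quot_rel quot_rel_refl quot_rel_sym quot_rel_trans.

Definition quot := {eq_quot quot_equiv}%qT.
HB.instance Definition _ := Choice.on quot.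

Definition quot_proj (x : R) : quot := (\pi_{eq_quot quot_equiv} x)%qT.
Definition quot_repr (a : quot) : R := repr (a : {eq_quot quot_equiv}%qT).

Lemma quot_reprK a : quot_proj (quot_repr a) = a.
Proof. exact: reprK. Qed.

Lemma quot_projP x y : quot_proj x = quot_proj y <-> I (x - y).
Proof. by rewrite (rwP (@eqmodP _ quot_equiv x y)) -(rwP (asboolP _)). Qed.

Lemma quot_repr_proj x : I (quot_repr (quot_proj x) - x).
Proof. by apply/quot_projP; rewrite quot_reprK. Qed.

Definition quot_add a b := quot_proj (quot_repr a + quot_repr b).
Definition quot_opp a := quot_proj (- quot_repr a).
Definition quot_mul a b := quot_proj (quot_repr a ** quot_repr b).

Lemma quot_projD x y : quot_proj (x + y) = quot_add (quot_proj x) (quot_proj y).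
Proof.
apply/esym/quot_projP; rewrite opprD addrACA.
by apply: idealD => //; apply: quot_repr_proj.
Qed.
Lemma quot_projN x : quot_proj (- x) = quot_opp (quot_proj x).
Proof. by apply/quot_projP; rewrite addrC opprK; apply: quot_repr_proj. Qed.
Lemma quot_projM x y : quot_proj (x ** y) = quot_mul (quot_proj x) (quot_proj y).
Proof.
apply/esym/quot_projP; rewrite -(subrKA (quot_repr (quot_proj x) ** y)) -rmulBr -rmulBl.
by apply: idealD => //; [apply: idealMl|apply: idealMr] => //; apply: quot_repr_proj.
Qed.

Lemma quot_ind (P : quot -> Prop) : (forall x, P (quot_proj x)) -> forall a, P a.
Proof. by move=> h a; rewrite -(quot_reprK a). Qed.

Fact quot_addA : associative quot_add.
Proof.
by do 3!elim/quot_ind=> ?; rewrite -!quot_projD addrA.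
Qed.
Fact quot_addC : commutative quot_add.
Proof. by do 2!elim/quot_ind=> ?; rewrite -!quot_projD addrC. Qed.
Fact quot_add0 : left_id (quot_proj 0) quot_add.
Proof. by elim/quot_ind=> ?; rewrite -!quot_projD add0r. Qed.
Fact quot_addN : left_inverse (quot_proj 0) quot_opp quot_add.
Proof. by elim/quot_ind=> ?; rewrite -quot_projN -quot_projD addNr. Qed.

HB.instance Definition _ :=
  GRing.isZmodule.Build quot quot_addA quot_addC quot_add0 quot_addN.

Fact quot_proj_is_additive : {morph @quot_proj : x y / x + y}.
Proof. exact: quot_projD. Qed.

Fact quot_mulA : associative quot_mul.
Proof. by do 3!elim/quot_ind=> ?; rewrite -!quot_projM rmulA. Qed.
Fact quot_mulDl : left_distributive quot_mul +%R.
Proof.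
do 3!elim/quot_ind=> ?.
by rewrite -quot_proj_is_additive -!quot_projM rmulDl quot_proj_is_additive.
Qed.
Fact quot_mulDr : right_distributive quot_mul +%R.
Proof.
do 3!elim/quot_ind=> ?.
by rewrite -quot_proj_is_additive -!quot_projM rmulDr quot_proj_is_additive.
Qed.

HB.instance Definition _ :=
  Zmodule_isRng.Build quot quot_mulA quot_mulDl quot_mulDr.

Fact quot_proj_morphism : rng_morphism quot_proj.
Proof. by split; [exact: quot_proj_is_additive|exact: quot_projM]. Qed.

Lemma quot_proj_eq0 x : quot_proj x = 0 <-> I x.
Proof. by rewrite quot_projP subr0. Qed.

End Quotient.

(** * Morphisms, images and preimages of ideals *)

Section RngMorphism.
Variables (R S : rngType) (f : R -> S) (fm : rng_morphism f).
Implicit Types (x y : R) (n : nat).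
Let fD : {morph f : x y / x + y} := fm.1.
Let fM : {morph f : x y / x ** y} := fm.2.

Lemma rng_morph0 : f 0 = 0.
Proof. by apply: (addrI (f 0)); rewrite -fD !addr0. Qed.
Lemma rng_morphN x : f (- x) = - f x.
Proof. by apply: (addrI (f x)); rewrite -fD !subrr rng_morph0. Qed.
Lemma rng_morphB x y : f (x - y) = f x - f y.
Proof. by rewrite fD rng_morphN. Qed.
Lemma rng_morphMn x n : f (x *+ n) = f x *+ n.
Proof. by elim: n => [|n IH]; rewrite ?rng_morph0 // !mulrS fD IH. Qed.
Lemma rng_morph_sum n (a : 'I_n -> R) : f (\sum_i a i) = \sum_i f (a i).
Proof. by elim/big_rec2: _ => [|i u v _ IH]; rewrite ?rng_morph0 // fD IH. Qed.

Lemma is_ideal_preimage (J : set S) : is_ideal J -> is_ideal (f @^-1` J).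
Proof.
move=> hJ; split=> [|x y Jx Jy|r x Jx|r x Jx]; rewrite /preimage /=.
- by rewrite rng_morph0; apply: ideal0.
- by rewrite rng_morphB; apply: idealB.
- by rewrite fM; apply: idealMl.
- by rewrite fM; apply: idealMr.
Qed.

Lemma image_ideal_mul (I J : set R) :
  f @` ideal_mul I J = ideal_mul (f @` I) (f @` J).
Proof.
apply/seteqP; split.
  move=> _ [_ [n [a [b [Ia Jb ->]]]] <-]; exists n, (f \o a), (f \o b).
  split; [by move=> i; exists (a i)|by move=> i; exists (b i)|].
  by rewrite rng_morph_sum; apply: eq_bigr => i _; rewrite fM.
move=> _ [n [a [b [Ia Jb ->]]]].
have /choice[a' Ia'] i : exists x, I x /\ f x = a i by have [x] := Ia i; exists x.
have /choice[b' Jb'] i : exists x, J x /\ f x = b i by have [x] := Jb i; exists x.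
exists (\sum_i a' i ** b' i).
  by exists n, a', b'; split=> // i; [case: (Ia' i)|case: (Jb' i)].
rewrite rng_morph_sum; apply: eq_bigr => i _.
by rewrite fM (Ia' i).2 (Jb' i).2.
Qed.

Lemma image_ideal_exp (I : set R) k : f @` ideal_exp I k = ideal_exp (f @` I) k.
Proof. by elim: k => //= k IH; rewrite image_ideal_mul IH. Qed.

Hypothesis f_surj : forall y : S, exists x, f x = y.

Lemma is_ideal_image (I : set R) : is_ideal I -> is_ideal (f @` I).
Proof.
move=> hI; split.
- by exists 0; [exact: ideal0|exact: rng_morph0].
- move=> _ _ [x Ix <-] [y Iy <-].
  by exists (x - y); [exact: idealB|exact: rng_morphB].
- move=> r _ [x Ix <-]; have [s <-] := f_surj r.
  by exists (s ** x); [exact: idealMl|exact: fM].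
- move=> r _ [x Ix <-]; have [s <-] := f_surj r.
  by exists (x ** s); [exact: idealMr|exact: fM].
Qed.

Lemma special_primary_image (N : set R) : maximal_ideal N ->
    (forall x, f x = 0 -> N x) ->
    (forall J, proper_ideal J -> (forall x, f x = 0 -> J x) ->
      exists k, J = ideal_exp N k) ->
  special_primary S.
Proof.
move=> hN kerN kerJ.
have imK (J : set S) : f @` (f @^-1` J) = J.
  apply/seteqP; split=> [_ [x Jx <-] //|y Jy].
  by have [x xy] := f_surj y; exists x; rewrite // /preimage /= xy.
have preN : f @^-1` (f @` N) = N.
  apply/seteqP; split=> [x [y Ny xy]|x Nx]; last by exists x.
  rewrite -(subrK y x); apply: (idealD hN.1.1) => //.
  by apply: kerN; rewrite rng_morphB xy subrr.
have preP J : proper_ideal J -> proper_ideal (f @^-1` J).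
  case=> hJ JT; split; first exact: is_ideal_preimage.
  move=> fJT; apply: JT; rewrite -(imK J) fJT.
  by apply/seteqP; split=> // y _; have [x xy] := f_surj y; exists x.
have pM : proper_ideal (f @` N).
  split; first exact: is_ideal_image hN.1.1.
  by move=> MT; apply: hN.1.2; rewrite -preN MT.
have expM J : proper_ideal J -> exists k, J = ideal_exp (f @` N) k.
  move=> /[dup] hJ /preP pJ; have [|k Jk] := kerJ _ pJ.
    by move=> x fx0; rewrite /preimage /= fx0; apply: ideal0 hJ.1.
  by exists k; rewrite -image_ideal_exp -Jk imK.
have maxM : maximal_ideal (f @` N).
  split=> // J hJ NJ; rewrite -(imK J); congr (f @` _).
  by apply: hN.2; [exact: preP|rewrite -preN; exact: preimage_subset].
exists (f @` N); split=> // N' hN'.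
(* A second maximal ideal is a power of the image of N, hence lies in that image, and its own
   maximality gives equality. *)
have [k N'k] := expM _ hN'.1.
by apply/esym/hN'.2 => //; rewrite N'k; apply: (ideal_expS (k := 0)) => //; apply: pM.1.
Qed.

End RngMorphism.

(** * Powers of maximal ideals in a pseudo BL-ring *)

Section PseudoBL.
Variables (R : rngType) (e : R) (he : two_sided_unit e) (RBL : pseudo_BL_ring R).
Let e_l : forall x, e ** x = x := he.1.
Let e_r : forall x, x ** e = x := he.2.
Implicit Types (I J X : set R) (x y : R).

(** PBLR-1 turns containment of ideals into divisibility, here with I as the left factor;
    [ideal_dvd_arrow] is the mirror image. *)
Lemma ideal_dvd_squig I J : is_ideal I -> is_ideal J -> J `<=` I ->
  J = ideal_mul I (squig I J).
Proof.
by case: RBL => _ h _ hI hJ JI; rewrite -(h _ _ hI hJ).1; apply/esym/setIidr.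
Qed.

Lemma ideal_dvd_arrow I J : is_ideal I -> is_ideal J -> J `<=` I ->
  J = ideal_mul (arrow I J) I.
Proof.
by case: RBL => _ h _ hI hJ JI; rewrite -(h _ _ hI hJ).2; apply/esym/setIidr.
Qed.

Section MaximalPowers.
Variables (N : set R) (hN : maximal_ideal N).
Let idN : is_ideal N := hN.1.1.
Local Notation P := (ideal_exp N).
Let idP k : is_ideal (P k) := is_ideal_exp k idN.

Lemma squig_eqT_sub I J : squig I J = setT -> I `<=` J.
Proof.
move=> IJ x Ix; rewrite -(e_r x).
by have IJe : squig I J e; [rewrite IJ|exact: IJe].
Qed.

(* By induction on k: if P k is not below I, then N <= (P k ~> I) is proper, so by
   prelinearity (I ~> P k) is not below N, hence is everything. *)
Lemma ideal_above_exp k I : proper_ideal I -> P k `<=` I ->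
  exists2 j, (j <= k)%N & I = P j.
Proof.
case=> hI IT; elim: k => [|k IH] PI.
  by exists 0%N => //; apply: hN.2.
have [PkI|PkI] := pselect (P k `<=` I).
  by have [j jk ->] := IH PkI; exists j => //; apply: leqW.
exists k.+1 => //.
have NPI : squig (P k) I = N.
  apply: hN.2; last by move=> y Ny x Px; apply/PI/ideal_mul_mem.
  by split; [exact: is_ideal_squig|move=> /squig_eqT_sub].
have IP : squig I (P k) = setT.
  have hS := is_ideal_squig hI (idP k).
  apply: (ideal_exp_sub_maximal he hN (k := k) hS).
    by move=> y Py x Ix; apply: idealMl.
  move=> SN; have [_ _ lin] := RBL.
  have [_ /(congr1 (fun A : set R => A e))] := lin _ _ hI (idP k).
  rewrite NPI => eT; have : ideal_add (squig I (P k)) N e by rewrite eT.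
  case=> a /SN Na [b Nb eab]; apply: (maximal_ideal_notin he hN).
  by rewrite eab; apply: idealD.
by rewrite (ideal_dvd_squig (idP k) hI (squig_eqT_sub IP)) NPI.
Qed.

(** Divisibility gives [Om] = V N with V = [arrow N Om], which settles the case of V inside [Om]. If
    V escapes some [P k], the powers become constant at k; then [Om] is contained in [P k.+1] =
    [P k] N, and [P k] in [Om]. *)
Lemma bigcap_exp_mulr : [set x | forall k, P k x] `<=` ideal_mul [set x | forall k, P k x] N.
Proof.
set Om := [set x | _]; have hOm : is_ideal Om by apply: is_ideal_bigcap.
have OmN : Om `<=` N by move=> x /(_ 0%N).
have hV := is_ideal_arrow idN hOm.
have [VOm|VOm] := pselect (arrow N Om `<=` Om).
  rewrite {1}(ideal_dvd_arrow idN hOm OmN); exact: ideal_mulS.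
have [k VPk] : exists k, ~ arrow N Om `<=` P k.
  apply: contrapT => nk; apply: VOm => x Vx k.
  by apply: contrapT => nPx; apply: nk; exists k => /(_ x Vx).
have PkS : P k `<=` P k.+1.
  have hW := is_ideal_arrow idN (idP k.+1).
  have PW : P k `<=` arrow N (P k.+1) by move=> y Py x Nx; apply: ideal_mul_mem.
  have [WT|WT] := pselect (arrow N (P k.+1) = setT).
    apply: subset_trans (ideal_expS idN (leq0n k)) _ => x Nx.
    by rewrite -(e_l x); have We : arrow N (P k.+1) e; [rewrite WT|exact: We].
  have [j jk Wj] := ideal_above_exp (conj hW WT) PW.
  (* Since V lies in W = [arrow N (P k.+1)] but not in [P k], W is a power [P j] with j < k. Then
     [P k] lies in [P j.+1] = W N, which lies in [P k.+1]. *)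
  have jltk : (j < k)%N.
    rewrite ltn_neqAle jk andbT; apply/eqP => ejk; apply: VPk.
    by rewrite -ejk -Wj => x Vx y Ny; apply: Vx.
  apply: subset_trans (ideal_expS idN jltk) _; apply: ideal_mul_min => // x y Px Ny.
  by have Wx : arrow N (P k.+1) x; [rewrite Wj|exact: Wx].
have PkOm : P k `<=` Om.
  suff Pm m : P k `<=` P (k + m)%N.
    by move=> x Px m; apply: (ideal_expS idN (leq_addl k m)); apply: Pm.
  elim: m => [|m IH]; first by rewrite addn0.
  rewrite addnS; apply: subset_trans PkS _; exact: ideal_mulS.
by move=> x /(_ k.+1); apply: ideal_mulS.
Qed.

(** With [Om] the intersection of the powers, X = V [Om] for V = [arrow Om X]. As [Om] lies in [Om]
    N, X lies in V [Om] N = X N. *)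
Lemma sub_bigcap_exp_mulr X : is_ideal X -> (forall k, X `<=` P k) ->
  X `<=` ideal_mul X N.
Proof.
move=> hX XP; have hOm : is_ideal [set x | forall k, P k x] by apply: is_ideal_bigcap.
have XOm : X `<=` [set x | forall k, P k x] by move=> x Xx k; apply: XP.
have hXN := is_ideal_mul hX idN; have hV := is_ideal_arrow hOm hX.
rewrite {1}(ideal_dvd_arrow hOm hX XOm); apply: ideal_mul_min => // v w Vv /bigcap_exp_mulr.
move=> [n [a [b [Oa Nb ->]]]]; rewrite rmul_sumr; apply: ideal_sum => // i.
by rewrite rmulA; apply: ideal_mul_mem => //; apply: Vv.
Qed.

Lemma sub_bigcap_exp_mulr_exp X k : is_ideal X -> (forall k, X `<=` P k) ->
  X `<=` ideal_mul X (P k).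
Proof.
move=> hX XP; have XN := sub_bigcap_exp_mulr hX XP; elim: k => [//|k IH].
have hXP := is_ideal_mul hX (idP k.+1).
apply: subset_trans XN _; apply: ideal_mul_min => // _ y /IH[n [a [b [Xa Pb ->]]]] Ny.
rewrite rmul_suml; apply: ideal_sum => // i.
by rewrite -rmulA; apply: ideal_mul_mem => //; exact: (ideal_mul_mem (Pb i) Ny).
Qed.

End MaximalPowers.

(** By [ideal_above_exp], the proper ideals above the kernel are powers of N. *)
Lemma special_primary_quot_exp N k : maximal_ideal N ->
  exists (S : rngType) (f : R -> S), [/\ special_primary S, rng_morphism f &
    forall x, f x = 0 <-> ideal_exp N k x].
Proof.
move=> hN; have hP := is_ideal_exp k hN.1.1.
exists (quot hP), (quot_proj hP); split; [|exact: quot_proj_morphism|exact: quot_proj_eq0].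
apply: (special_primary_image (@quot_proj_morphism _ _ hP) _ hN).
- by move=> a; exists (quot_repr a); exact: quot_reprK.
- by move=> x /quot_proj_eq0; apply: (ideal_expS hN.1.1 (leq0n k)).
- move=> J pJ kerJ; have [|j _ ->] := ideal_above_exp hN (k := k) pJ; last by exists j.
  by move=> x Px; apply: kerJ; apply/quot_proj_eq0.
Qed.

(* Let X be the ideal spanned by x and N a maximal ideal above its right
   annihilator A.  If X lies in all powers of N, then X = X N^k for all k.
   Either nR lies in all powers of N, so that nR = nN, n1 = nj with j in N, and
   1 - j in A; or nR = N^k U with U not below N, and XU = X N^k U = 0. *)
Lemma torsion_multiple_separated n x : x <> 0 -> x *+ n = 0 ->
    range (fun z : R => z *+ n) x ->
  exists N k, maximal_ideal N /\ ~ ideal_exp N k x.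
Proof.
move=> x0 nx0 nRx; pose c := range (fun z : R => z *+ n).
have hc : is_ideal c := is_ideal_multiples R n.
pose X := [set w | forall I, is_ideal I -> I x -> I w].
have hX : is_ideal X.
  split=> [I hI _|u v Xu Xv I hI Ix|r u Xu I hI Ix|r u Xu I hI Ix].
  - exact: ideal0.
  - by apply: idealB => //; [apply: Xu|apply: Xv].
  - by apply: idealMl => //; apply: Xu.
  - by apply: idealMr => //; apply: Xu.
have Xx : X x by [].
have Xmin I : is_ideal I -> I x -> X `<=` I by move=> hI Ix w; apply.
have h0 : is_ideal [set (0 : R)].
  by split=> [|_ _ -> ->|r _ ->|r _ ->] //=; rewrite ?subrr ?rmul0 ?r0mul.
pose A := squig X [set 0]; have hA : is_ideal A by apply: is_ideal_squig.
have [|N hN AN] := maximal_ideal_exists he (I := A).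
  split=> // AT; apply: x0; rewrite -(e_r x).
  by have Ae : A e; [rewrite AT|exact: Ae].
have [idN eN] := (hN.1.1, maximal_ideal_notin he hN).
have Xn w : X w -> w *+ n = 0.
  apply: (Xmin [set w | w *+ n = 0]) => //.
  split=> [|u v u0 v0|r u u0|r u u0] /=; first by rewrite mul0rn.
  - by rewrite mulrnBl u0 v0 subr0.
  - by rewrite -rmulMnr u0 rmul0.
  - by rewrite -rmulMnl u0 r0mul.
have cA : c `<=` A by move=> _ [z _ <-] w Xw /=; rewrite rmulMnr -rmulMnl Xn // r0mul.
apply: contrapT => nsep.
have XP k : X `<=` ideal_exp N k.
  apply: Xmin; first exact: is_ideal_exp.
  by apply: contrapT => nP; apply: nsep; exists N, k.
have [cP|cP] := pselect (forall k, c `<=` ideal_exp N k).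
  have [j Nj ej] : exists2 j, N j & e *+ n = j *+ n.
    have /(sub_bigcap_exp_mulr hN hc cP)[m [a [b [ca Nb ->]]]] : c (e *+ n) by exists e.
    have /choice[a' Ea] i : exists z, z *+ n = a i by have [z] := ca i; exists z.
    exists (\sum_i a' i ** b i); first by apply: ideal_sum => // i; apply: idealMl.
    by rewrite -sumrMnl; apply: eq_bigr => i _; rewrite -rmulMnl Ea.
  (* As x lies in nR, each w in X is some [z *+ n], so w (e - j) = z (n e - n j) = 0. Thus [e - j]
     lies in A, hence in N, which forces [e] into N. *)
  apply: eN; rewrite -(subrK j e); apply: (idealD idN) => //; apply: AN => w /(Xmin c).
  case=> // z _ <- /=; rewrite rmulBr e_r.
  by rewrite -{1}(e_r z) -rmulMnr ej rmulMnl rmulMnr subrr.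
have [k [cPk cPkS]] : exists k, c `<=` ideal_exp N k /\ ~ c `<=` ideal_exp N k.+1.
  apply: contrapT => nk; apply: cP; elim=> [|k IH]; first exact: subset_trans cA AN.
  by apply: contrapT => cPS; apply: nk; exists k.
have hP := is_ideal_exp k idN; have hU := is_ideal_squig hP hc.
have cU := ideal_dvd_squig hP hc cPk.
(* Once U is shown to annihilate X it lies in A, hence in N, and nR = N^k U falls into the next
   power, against the choice of k. *)
apply: cPkS; rewrite cU; apply: ideal_mulS => // u Uu; apply: AN => w.
move=> /(sub_bigcap_exp_mulr_exp hN k hX XP)[m [a [b [Xa Pb ->]]]].
rewrite rmul_suml; apply: ideal_sum => // i; rewrite -rmulA.
have /cA : c (b i ** u) by rewrite cU; apply: ideal_mul_mem.
exact.
Qed.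

End PseudoBL.

(** * Groups of additive maps *)

Section Hom.
Variables U V : zmodType.

Record hom := Hom { hom_fun :> U -> V; homD : {morph hom_fun : x y / x + y} }.

HB.instance Definition _ := gen_eqMixin hom.
HB.instance Definition _ := gen_choiceMixin hom.

Lemma homP (f g : hom) : f =1 g -> f = g.
Proof.
case: f g => [f fD] [g gD] /= fgE.
have fg : f = g by apply: functional_extensionality_dep.
by move: gD; rewrite -fg => gD; congr Hom; apply: Prop_irrelevance.
Qed.

Fact hom_zeroD : {morph (fun=> 0 : V) : x y / (x : U) + y >-> x + y}.
Proof. by move=> x y; rewrite addr0. Qed.
Fact hom_oppD (f : hom) : {morph (fun x => - f x) : x y / x + y}.
Proof. by move=> x y; rewrite homD opprD. Qed.
Fact hom_addD (f g : hom) : {morph (fun x => f x + g x) : x y / x + y}.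
Proof. by move=> x y; rewrite !homD addrACA. Qed.

Definition hom_zero := Hom hom_zeroD.
Definition hom_opp f := Hom (hom_oppD f).
Definition hom_add f g := Hom (hom_addD f g).

Fact hom_addA : associative hom_add.
Proof. by move=> f g h; apply: homP => x; apply: addrA. Qed.
Fact hom_addC : commutative hom_add.
Proof. by move=> f g; apply: homP => x; apply: addrC. Qed.
Fact hom_add0 : left_id hom_zero hom_add.
Proof. by move=> f; apply: homP => x; apply: add0r. Qed.
Fact hom_addN : left_inverse hom_zero hom_opp hom_add.
Proof. by move=> f; apply: homP => x; apply: addNr. Qed.

HB.instance Definition _ :=
  GRing.isZmodule.Build hom hom_addA hom_addC hom_add0 hom_addN.

Fact hom_zmod_morphism (f : hom) : zmod_morphism f.
Proof.
by move=> x y; apply: (addIr (f y)); rewrite -homD !subrK.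
Qed.

HB.instance Definition _ (f : hom) :=
  GRing.isZmodMorphism.Build U V f (hom_zmod_morphism f).

End Hom.

(** * Extension of additive maps into vector spaces *)

Section AdditiveExtension.
Variables (F : fieldType) (U V : zmodType) (D : lmodType F).
Variables (i : hom U V) (p : hom U D) (G0 : set V).

Definition is_subgroup (G : set V) := G 0 /\ forall x y, G x -> G y -> G (x - y).

Let subgroupN G x : is_subgroup G -> G x -> G (- x).
Proof. by case=> G_0 GB Gx; rewrite -sub0r; apply: GB. Qed.

Let subgroupD G x y : is_subgroup G -> G x -> G y -> G (x + y).
Proof. by move=> hG Gx Gy; rewrite -[y]opprK; apply: hG.2 => //; apply: subgroupN. Qed.

Let subgroupMz G x n : is_subgroup G -> G x -> G (x *~ n).
Proof.
move=> hG Gx; have GM m : G (x *+ m).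
  by elim: m => [|m IH]; [exact: hG.1|rewrite mulrS; apply: subgroupD].
by case: n => m; [exact: GM|rewrite NegzE mulrNz; apply: subgroupN => //; exact: GM].
Qed.

Hypothesis hG0 : is_subgroup G0.
(** Every additive map into D kills [v *~ n] when n vanishes in F; together with [G0_ker] this makes
    p compatible with that constraint. *)
Hypothesis G0_char : forall (n : int) v, n%:~R = 0 :> F -> G0 (v *~ n).
Hypothesis G0_ker : forall a, G0 (i a) -> p a = 0.

(* Zorn gives a largest subgroup G with the property of G0 expressed by
   G0_ker.  By maximality every v has a multiple n v = i a modulo G with n
   invertible in F, and v is sent to n^-1 p a. *)
Lemma additive_extension :
  exists f : hom V D, forall a, f (i a) = p a.
Proof.
pose P G := [/\ is_subgroup G, G0 `<=` G & forall a, G (i a) -> p a = 0].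
have [|C [X0 CX0] CP Ctot|G [[hG G0G Gker] _ Gmax]] := @Zorn_bigcup_above _ P G0.
- by split.
- have Csub X : C X -> is_subgroup X by case/CP.
  split; last by move=> a [X /CP[_ _ h]]; apply: h.
    split; first by exists X0 => //; case: (Csub _ CX0).
    move=> x y [X CX Xx] [Y CY Yy].
    have [XY|YX] := Ctot _ _ CX CY; [exists Y|exists X] => //.
      by apply: (Csub _ CY).2 => //; apply: XY.
    by apply: (Csub _ CX).2 => //; apply: YX.
  by move=> x G0x; exists X0 => //; case/CP: CX0 => _ h _; apply: h.
pose rel v d := exists (n : int) a,
  [/\ n%:~R != 0 :> F, G (v *~ n - i a) & n%:~R *: d = p a].
have rel_ex v : exists d, rel v d.
  suff [n [a [n0 Gna]]] : exists (n : int) a, n%:~R != 0 :> F /\ G (v *~ n - i a).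
    by exists (n%:~R^-1 *: p a), n, a; split=> //; rewrite scalerA divff // scale1r.
  (* G' is G + Zv. If no n invertible in F worked, G' would still satisfy P, so by maximality v
     would lie in G, and then n = 1, a = 0 would work. *)
  pose G' := [set w | exists (n : int) g, G g /\ w = v *~ n + g].
  apply: contrapT => nv.
  have PG' : P G'.
    split.
    - split; first by exists 0, 0; rewrite mulr0z addr0; split=> //; exact: hG.1.
      move=> _ _ [n [g [Gg ->]]] [m [h [Gh ->]]]; exists (n - m), (g - h).
      by split; [exact: hG.2|rewrite mulrzBr opprD addrACA].
    - by move=> w G0w; exists 0, w; rewrite mulr0z add0r; split=> //; apply: G0G.
    move=> a [n [g [Gg ia]]]; have [n0|n0] := eqVneq (n%:~R : F) 0.
      by apply: Gker; rewrite ia; apply: subgroupD => //; apply/G0G/G0_char.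
    case: nv; exists n, a; split=> //.
    by rewrite ia opprD addrA subrr sub0r; apply: subgroupN.
  have GG' : G `<=` G' by move=> g Gg; exists 0, g; rewrite mulr0z add0r.
  apply: nv; exists 1, 0; rewrite oner_eq0 raddf0 subr0 -(Gmax _ PG' GG').
  by split=> //; exists 1, 0; rewrite addr0; split=> //; exact: hG.1.
have rel_add v w d c : rel v d -> rel w c -> rel (v + w) (d + c).
  move=> [n [a [n0 Gn nd]]] [m [b [m0 Gm mc]]]; exists (n * m), (a *~ m + b *~ n); split.
  - by rewrite intrM mulf_neq0.
  - have -> : (v + w) *~ (n * m) - i (a *~ m + b *~ n) =
        (v *~ n - i a) *~ m + (w *~ m - i b) *~ n.
      rewrite homD !raddfMz /= !mulrzBl mulrzDl -!mulrzA [(m * n)%R]mulrC.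
      by rewrite opprD addrACA.
    by apply: subgroupD => //; apply: subgroupMz.
  - rewrite homD !raddfMz /= -nd -mc -!scaler_int !scalerA -!intrM scalerDr.
    by rewrite [(m * n)%R]mulrC.
have rel_opp v d : rel v d -> rel (- v) (- d).
  move=> [n [a [n0 Gn nd]]]; exists n, (- a); split=> //.
    by rewrite mulNrz raddfN -opprD; apply: subgroupN.
  by rewrite scalerN nd raddfN.
have rel0 d : rel 0 d -> d = 0.
  move=> [n [a [n0 Gn nd]]]; have /eqP : n%:~R *: d = 0.
    rewrite nd; apply: Gker; rewrite -[i a]opprK; apply: subgroupN => //.
    by rewrite mul0rz sub0r in Gn.
  by rewrite scaler_eq0 (negbTE n0) => /eqP.
have rel_uniq v d c : rel v d -> rel v c -> d = c.
  move=> vd /rel_opp vc; apply/eqP; rewrite -subr_eq0; apply/eqP/rel0.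
  by rewrite -(subrr v); apply: rel_add.
have [f fP] := choice rel_ex.
have fD : {morph f : v w / v + w}.
  by move=> v w; exact: rel_uniq (fP _) (rel_add _ _ _ _ (fP v) (fP w)).
exists (Hom fD) => a; apply: rel_uniq (fP _) _; exists 1, a; rewrite oner_eq0 subrr scale1r.
by split=> //; exact: hG.1.
Qed.

End AdditiveExtension.

(** This is [additive_extension] for U = Z, sent to V by multiples of x and to F canonically. *)
Lemma additive_functional (F : fieldType) (V : zmodType) (G0 : set V) (x : V) :
    is_subgroup G0 -> (forall (n : int) v, n%:~R = 0 :> F -> G0 (v *~ n)) ->
    (forall n : int, G0 (x *~ n) -> n%:~R = 0 :> F) ->
  exists f : hom V F^o, f x = 1.
Proof.
move=> hG0 G0_char G0_x.
have iD : {morph (fun n : int => x *~ n) : m n / m + n}.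
  by move=> m n; rewrite mulrzDr.
have pD : {morph (fun n : int => n%:~R : F^o) : m n / m + n}.
  by move=> m n; rewrite intrD.
have [f fE] := @additive_extension F _ V F^o (Hom iD) (Hom pD) G0 hG0 G0_char G0_x.
by exists f; rewrite -[x]mulr1z; exact: (fE 1).
Qed.

(** * Vector spaces of additive maps and endomorphism rings *)

Section HomLmodule.
Variables (F : fieldType) (U : zmodType) (V : lmodType F).
Implicit Types (a b : F) (f g : hom U V).

Fact hom_scaleD a f : {morph (fun x => a *: f x) : x y / x + y}.
Proof. by move=> x y; rewrite homD scalerDr. Qed.
Definition hom_scale a f := Hom (hom_scaleD a f).

Fact hom_scaleA a b f : hom_scale a (hom_scale b f) = hom_scale (a * b) f.
Proof. by apply: homP => x; apply: scalerA. Qed.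
Fact hom_scale1 : left_id 1 hom_scale.
Proof. by move=> f; apply: homP => x; apply: scale1r. Qed.
Fact hom_scaleDr : right_distributive hom_scale +%R.
Proof. by move=> a f g; apply: homP => x; apply: scalerDr. Qed.
Fact hom_scaleDl f : {morph hom_scale^~ f : a b / a + b}.
Proof. by move=> a b; apply: homP => x; apply: scalerDl. Qed.

HB.instance Definition _ :=
  GRing.Zmodule_isLmodule.Build F (hom U V) hom_scaleA hom_scale1 hom_scaleDr hom_scaleDl.

End HomLmodule.

Section Endomorphisms.
Variable V : zmodType.
Definition endo := hom V V.
HB.instance Definition _ := GRing.Zmodule.on endo.

Fact endo_compD (f g : endo) : {morph (fun x => f (g x)) : x y / x + y}.
Proof. by move=> x y; rewrite !homD. Qed.
Definition endo_comp (f g : endo) : endo := Hom (endo_compD f g).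

Fact endo_compA : associative endo_comp.
Proof. by move=> f g h; apply: homP. Qed.
Fact endo_compDl : left_distributive endo_comp +%R.
Proof. by move=> f g h; apply: homP. Qed.
Fact endo_compDr : right_distributive endo_comp +%R.
Proof. by move=> f g h; apply: homP => x; apply: homD. Qed.

HB.instance Definition _ := Zmodule_isRng.Build endo endo_compA endo_compDl endo_compDr.

Fact endo_idD : {morph (@id V) : x y / x + y}.
Proof. by []. Qed.
Definition endo_id : endo := Hom endo_idD.

Lemma endo_id_unit : two_sided_unit endo_id.
Proof. by split=> f; apply: homP. Qed.

End Endomorphisms.

(** * Separation by simple quotients *)

(** The quotient is simple: the only proper ideal above N is N, its own first power, which has index
    0 in [ideal_exp]. *)
Lemma special_primary_quot_maximal (R : rngType) (N : set R)
    (hN : maximal_ideal N) : special_primary (quot hN.1.1).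
Proof.
apply: (special_primary_image (@quot_proj_morphism _ _ hN.1.1) _ hN).
- by move=> a; exists (quot_repr a); exact: quot_reprK.
- by move=> x /quot_proj_eq0.
- move=> J pJ NJ; exists 0%N; apply: hN.2 => // x Nx.
  by apply: NJ; apply/quot_proj_eq0.
Qed.

(** An ideal containing [a] contains u a v = [e], so [a] survives modulo any maximal ideal. *)
Lemma simple_quotient_separated (E : rngType) (e a u v : E) :
    two_sided_unit e -> e <> 0 -> u ** a ** v = e ->
  exists (S : rngType) (f : E -> S), [/\ special_primary S, rng_morphism f & f a <> 0].
Proof.
move=> he e0 uav; have [|N hN _] := maximal_ideal_exists he (I := [set 0]).
  split=> [|T0]; last by apply: e0; have Te : [set (0 : E)] e; [rewrite T0|exact: Te].
  by split=> [|_ _ -> ->|r _ ->|r _ ->] //=; rewrite ?subrr ?rmul0 ?r0mul.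
exists (quot hN.1.1), (quot_proj hN.1.1); split.
- exact: special_primary_quot_maximal.
- exact: quot_proj_morphism.
move=> /quot_proj_eq0 Na; apply: (maximal_ideal_notin he hN); rewrite -uav.
by apply: idealMr (hN.1.1) _ _ _; apply: idealMl (hN.1.1) _ _ _.
Qed.

(* R acts on H = Hom(R, F) by (r h)(y) = h(yr), hence on V = H^(seq R).  As H
   embeds into F^R by evaluation and seq R contains R * seq R, V embeds into
   F^(seq R), with an additive left inverse.  Multiplying the coordinates by f
   with (x f)(e) <> 0 sends F^(seq R) back to V, so that x becomes a factor of
   the identity of V: u x v = id. *)
Section ActionOnFunctionals.
Variables (R : rngType) (F : fieldType).

Local Notation H := (hom R F^o).
Local Notation V := (seq R -> H).

Fact act_homD (r : R) (h : H) : {morph (fun y => h (y ** r)) : x y / x + y}.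
Proof. by move=> x y; rewrite rmulDl homD. Qed.
Definition act_hom r h : H := Hom (act_homD r h).

Fact actD (r : R) : {morph (fun (w : V) t => act_hom r (w t)) : x y / x + y}.
Proof. by move=> v w; apply: functional_extensionality_dep => t; apply: homP. Qed.
Definition act r : endo V := Hom (actD r).

Lemma act_morphism : rng_morphism act.
Proof.
split=> r s; apply: homP => w; apply: functional_extensionality_dep => t; apply: homP => y.
  by rewrite /= rmulDr homD.
by rewrite /= rmulA.
Qed.

(** The index [y :: t] reads coordinate t at y, so no value of w is lost. At [[::]] the defaults
    read [w [::]] at 0, which is 0. *)
Fact encodeD : {morph (fun (w : V) t => w (behead t) (head 0 t)) : v w / v + w}.
Proof. by []. Qed.
Definition encode : hom V (seq R -> F^o) := Hom encodeD.

Lemma encode_inj w : encode w = 0 -> w = 0.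
Proof.
move=> w0; apply: functional_extensionality_dep => t; apply: homP => y.
exact: (congr1 (fun g : seq R -> F^o => g (y :: t)) w0).
Qed.

(** The identity of V is extended along the injection [encode]. The zero subgroup can serve as [G0]
    because the target is a vector space over F. *)
Lemma decode_exists : exists d : hom (seq R -> F^o) V, forall w, d (encode w) = w.
Proof.
have idD : {morph @id V : v w / v + w} by [].
apply: (@additive_extension F V (seq R -> F^o) V encode (Hom idD) [set 0]).
- by split=> // _ _ -> ->; rewrite /= subrr.
- by move=> n v n0; rewrite /= -scaler_int n0 scale0r.
- by move=> w /encode_inj.
Qed.

Lemma functional_separated (e x : R) (f : H) : two_sided_unit e -> f x <> 0 ->
  exists (S : rngType) (g : R -> S), [/\ special_primary S, rng_morphism g & g x <> 0].
Proof.
move=> he fx0; have [d dE] := decode_exists.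
have vD : {morph (fun (w : V) t => encode w t *: f) : v w / v + w}.
  move=> v w; apply: functional_extensionality_dep => t.
  by rewrite homD scalerDl.
(* Since [act x] sends f to a functional with value f (e x) = f x at [e], dividing the value at [e]
   by [f x] recovers [encode w t], and [d] recovers w. *)
have uD : {morph (fun w : V => d (fun t => (f x)^-1 *: w t e)) : v w / v + w}.
  move=> v w; rewrite -homD; congr (d _); apply: functional_extensionality_dep => t.
  by rewrite /= -scalerDr.
have [|||S [g [hS gM gx]]] := @simple_quotient_separated (endo V) (endo_id V)
    (act x) (Hom uD) (Hom vD).
- exact: endo_id_unit.
- move=> /(congr1 (fun h : endo V => h (fun=> f) [::] x)); exact: fx0.
- apply: homP => w; rewrite -[RHS]dE; congr (d _).
  apply: functional_extensionality_dep => t /=; rewrite he.1.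
  rewrite -[RHS]mul1r -(mulVf (introN eqP fx0)) -mulrA; congr (_ * _).
  exact: mulrC.
exists S, (g \o act); split=> //.
by split=> r s /=; rewrite ?act_morphism.1 ?act_morphism.2 ?gM.1 ?gM.2.
Qed.

End ActionOnFunctionals.

(** * Separation of nonzero elements and the embedding into a product *)

Lemma special_primary_separated (R : rngType) (e x : R) :
    two_sided_unit e -> pseudo_BL_ring R -> x <> 0 ->
  exists (S : rngType) (g : R -> S), [/\ special_primary S, rng_morphism g & g x <> 0].
Proof.
move=> he RBL x0.
have [[n n0 nx]|tf] := pselect (exists2 n, (0 < n)%N & x *+ n = 0); last first.
  have [|n v|n|f fx1] := @additive_functional rat R [set 0] x.
  - by split=> // _ _ -> ->; rewrite /= subrr.
  - by move=> /eqP; rewrite intr_eq0 => /eqP ->.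
  - move=> xn; have [-> //|n0] := eqVneq n 0; case: tf.
    exists `|n|%N; first by rewrite absz_gt0.
    by case: n xn {n0} => n //=; rewrite NegzE mulrNz => /eqP; rewrite oppr_eq0 => /eqP.
  by apply: (functional_separated (f := f) he); rewrite fx1; apply/eqP/oner_neq0.
have [p [m [p_pr mx0 pmx]]] : exists p m, [/\ prime p, x *+ m <> 0 & x *+ m *+ p = 0].
  have exn : exists n, (0 < n)%N && (x *+ n == 0) by exists n; rewrite n0 nx eqxx.
  case: (ex_minnP exn) => {n0 nx}n /andP[n0 /eqP nx] nmin.
  have n1 : (1 < n)%N.
    by rewrite ltn_neqAle n0 andbT; apply/eqP => n1; apply: x0; rewrite -nx -n1.
  (* Here n is the least positive integer killing x, so its proper divisor n / p leaves x
     nonzero. *)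
  exists (pdiv n), (n %/ pdiv n)%N; split; first exact: pdiv_prime.
    move=> mx; have := nmin (n %/ pdiv n)%N.
    rewrite mx eqxx andbT divn_gt0 ?pdiv_gt0 // dvdn_leq ?pdiv_dvd // => /(_ isT).
    by rewrite leqNgt ltn_Pdiv // prime_gt1 // pdiv_prime.
  by rewrite -mulrnA divnK // pdiv_dvd.
suff [S [g [hS gM gx]]] : exists (S : rngType) (g : R -> S),
    [/\ special_primary S, rng_morphism g & g (x *+ m) <> 0].
  exists S, g; split=> // gx0; apply: gx.
  by rewrite (rng_morphMn gM) gx0 mul0rn.
move: (x *+ m) mx0 pmx => {x0 n n0 nx}y y0 py.
have [pRy|pRy] := pselect (range (fun z : R => z *+ p) y).
  have [N [k [hN Ny]]] := torsion_multiple_separated he RBL y0 py pRy.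
  have [S [g [hS gM gker]]] := special_primary_quot_exp he RBL k hN.
  by exists S, g; split=> // /gker.
have pchar := pchar_Fp p_pr.
have hpR := is_ideal_multiples R p.
have [|n v|n|f fy1] := @additive_functional 'F_p R (range (fun z : R => z *+ p)) y.
- by case: hpR.
- move=> /eqP; rewrite -(dvdz_pcharf pchar) => /dvdzP[q ->].
  by exists (v *~ q); rewrite // mulrzA.
- case=> z _ zp; apply/eqP; rewrite -(dvdz_pcharf pchar); apply: contra_notT pRy => pn.
  (* If p does not divide n, then a p + b n = 1 and n y = p z give y = p (a y + b z), against y not
     being in pR. *)
  have [a [b ab]] := Bezoutz p n.
  have {}ab : a * p + b * n = 1.
    rewrite ab; congr Posz; apply/eqP; rewrite -/(coprime _ _) prime_coprime //.
  exists (y *~ a + z *~ b) => //.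
  rewrite -[RHS]mulr1z -ab mulrzDr mulrzA mulrnDl [b * n]mulrC mulrzA -zp.
  by congr (_ + _); rewrite !pmulrn -!mulrzA mulrC.
by apply: (functional_separated (f := f) he); rewrite fy1; apply/eqP/oner_neq0.
Qed.

Theorem proposition4p4 (R : rngType)
    (unitL : exists oneL : R, left_unit oneL)
    (unitR : exists oneR : R, right_unit oneR)
    (RBL : pseudo_BL_ring R) :
  exists (I : Type) (S : I -> rngType),
    (forall i : I, special_primary (S i)) /\
    isomorphic_to_subring R (rng_prod S).
Proof.
case: unitL unitR => e e_l [e' e'_r].
(* The two units coincide: [e] = [e ** e'] = [e']. *)
have he : two_sided_unit e by split=> // x; rewrite -(e'_r e) e_l.
(* One factor is taken for each nonzero element, chosen to separate it from 0; for x and y distinct,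
   the factor indexed by [x - y] distinguishes them. *)
pose I := {x : R | x <> 0}.
have /choice[S SP] (i : I) : exists S : rngType, exists g : R -> S,
    [/\ special_primary S, rng_morphism g & g (sval i) <> 0].
  exact: special_primary_separated he RBL (svalP i).
have g_ex (i : I) := cid (SP i).
pose g (x : R) : rng_prod S := fun i => sval (g_ex i) x.
have gP i := svalP (g_ex i).
have gM : rng_morphism g.
  by split=> x y; apply: functional_extensionality_dep => i; have [_ [gD gM] _] := gP i;
    [exact: gD|exact: gM].
exists I, S; split; first by move=> i; have [] := gP i.
exists (range g); split.
  split; first by exists 0; rewrite ?(rng_morph0 gM).
  - by move=> _ _ [x _ <-] [y _ <-]; exists (x - y); rewrite ?(rng_morphB gM).
  - by move=> _ _ [x _ <-] [y _ <-]; exists (x ** y); rewrite ?gM.2.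
exists g; split=> //; split=> [x _|x y _ _ gxy|_ [x _ <-]]; [by exists x| |by exists x].
apply: subr0_eq; apply: contrapT => xy0.
pose i : I := exist _ (x - y) xy0; have [_ _] := gP i; apply.
have gxy0 : g (x - y) = 0 by rewrite (rng_morphB gM) gxy subrr.
exact: (congr1 (fun h : rng_prod S => h i) gxy0).
Qed.
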